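(* Let $n\le m$ be positive integers and let $X=(x_{ij})$ be an $n\times m$ matrix of indeterminates. Then the set of maximal minors of $X$ (the determinants of the $n\times n$ submatrices of $X$ formed by choosing $n$ distinct columns) is an amoeba basis for the ideal of $\mathbb{C}[x_{ij} : 1\le i\le n,\ 1\le j\le m]$ that they generate.
   Context: Write $\mathbb{C}^*=\mathbb{C}\setminus\{0\}$. For a complex variety $V\subseteq\mathbb{C}^N$, its amoeba is $\mathcal{A}(V)=\{(\log|z_1|,\ldots,\log|z_N|) : z\in V\cap(\mathbb{C}^* )^N\}\subseteq\mathbb{R}^N$. For an ideal $I$, $V(I)$ is its zero set in $\mathbb{C}^N$; for a polynomial $f$, $\mathcal{A}(f)$ denotes $\mathcal{A}(V(f))$, the amoeba of the zero set of $f$. Given an ideal $I\subseteq\mathbb{C}[z_1,\ldots,z_N]$, a finite set $B\subset I$ is called an amoeba basis for $I$ if $B$ generates $I$ and satisfies $\mathcal{A}(V(I))=\bigcap_{f\in B}\mathcal{A}(f)$, while no proper subset of $B$ does (i.e. no proper subset of $B$ both generates $I$ and satisfies this equality). *)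

(* Defs.v *)
From HB Require Import structures.
From mathcomp Require Import all_boot all_order all_algebra.
From mathcomp Require Import classical_sets cardinality reals exp.
From mathcomp Require Import complex.
(* The notations of mpoly clash with those of MathComp-Analysis. *)
From mathcomp Require Import -(notations) mpoly.

Set Implicit Arguments.
Unset Strict Implicit.
Unset Printing Implicit Defensive.

Import Order.TTheory GRing.Theory Num.Theory.
Local Open Scope classical_set_scope.
Local Open Scope ring_scope.

(* ring_quotient's idealr only covers proper ideals; here the unit ideal is
   an ideal too. *)
Definition is_ideal (A : comNzRingType) (I : set A) : Prop :=
  [/\ I 0, forall p q, I p -> I q -> I (p + q)
    & forall a p, I p -> I (a * p)].

Definition ideal_gen (A : comNzRingType) (B : set A) : set A :=
  smallest (@is_ideal A) B.

Section Amoebas.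
Context {R : realType} {N : nat}.

Local Notation cpoly := (mpoly N R[i]).

Definition zero_locus (S : set cpoly) : set 'rV[R[i]]_N :=
  [set z : 'rV[R[i]]_N | forall p, S p -> meval (z 0) p = 0].

Definition torus : set 'rV[R[i]]_N := [set z : 'rV[R[i]]_N | forall k, z 0 k != 0].

(* normc is the modulus as an element of R (`|z| has type R[i]). *)
Definition Log (z : 'rV[R[i]]_N) : 'rV[R]_N := \row_k ln (Normc.normc (z 0 k)).

Definition amoeba (V : set 'rV[R[i]]_N) : set 'rV[R]_N :=
  [set Log z | z in V `&` torus].

Definition amoeba_poly (f : cpoly) : set 'rV[R]_N := amoeba (zero_locus [set f]).

Definition generates_with_amoeba (I B : set cpoly) : Prop :=
  ideal_gen B = I /\ amoeba (zero_locus I) = \bigcap_(f in B) amoeba_poly f.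

Definition amoeba_basis (I B : set cpoly) : Prop :=
  [/\ finite_set B, B `<=` I, generates_with_amoeba I B
    & forall B' : set cpoly, B' `<` B -> ~ generates_with_amoeba I B'].

End Amoebas.

(* The n * m indeterminates are numbered by the bijection mxvec_index from
   'I_n * 'I_m to 'I_(n * m). *)
Definition generic_matrix (R : realType) (n m : nat) :
    'M[mpoly (n * m) R[i]]_(n, m) :=
  \matrix_(i, j) mpolyX R[i] (mnm1 (mxvec_index i j)).

(* A choice of n distinct columns is a strictly increasing map 'I_n -> 'I_m:
   the chosen columns keep their order, so each choice gives one minor. *)
Definition maximal_minors (A : comNzRingType) (n m : nat) (X : 'M[A]_(n, m)) :
    set A :=
  [set d | exists2 f : 'I_n -> 'I_m,
     {homo f : i j / (i < j)%N} & d = \det (colsub f X)].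

(* Main.v *)
Require Import Defs.
From mathcomp Require Import all_boot all_order all_algebra.
From mathcomp Require Import classical_sets reals complex.
From mathcomp Require Import -(notations) mpoly.
From mathcomp Require Import boolp cardinality sequences exp ring lra zify.

(** Fix positive moduli [rho i j] for the entries of an [n * m] matrix.  Phases
    making the matrix have rank less than [n] exist iff some nonzero row [v]
    kills it; for the [j]-th column this means that the complex numbers
    [v i * z i j], whose moduli are [t i * rho i j] with [t i = |v i|], sum to
    zero.  Phases with this property exist iff no [t i * rho i j] exceeds the
    sum of the others (the polygon inequalities): necessity is
    [balanced_of_kernel], and sufficiency, [kernel_of_balanced], is built from
    triangles in [polygon_phases].  So, for each column separately, the
    admissible [t] form a convex cone cut out by linear inequalities in the
    nonnegative orthant of R^n, and rank deficiency is possible iff the cones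
    of all columns have a common nonzero point.

    A point lies in the amoeba of one maximal minor iff the [n] cones of its
    columns have a common nonzero point.  Helly's theorem, applied to the
    sections of the cones by the simplex of dimension [n - 1], says that
    if every [n] of the cones have such a point then all of them do
    ([helly_cones], [singular_minors_moduli]).  This is the inclusion of the
    intersection of the amoebas of the minors in the amoeba of the ideal; the
    other one is immediate.

    No minor can be omitted, because it does not even belong to the ideal
    generated by the others: at the matrix with the identity in the chosen
    columns and zeros elsewhere it is 1, while every other minor has a zero
    column ([minor_notin_ideal]). *)

Set Implicit Arguments.
Unset Strict Implicit.
Unset Printing Implicit Defensive.

Import Order.TTheory GRing.Theory Num.Theory Normc.
Local Open Scope ring_scope.
Local Open Scope complex_scope.

(** * Closing polygons with prescribed side lengths *)

Section Polygons.
Context {R : rcfType}.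

Lemma normc_nneg (x : R) : 0 <= x -> normc x%:C = x.
Proof. by move=> x0; rewrite /normc /= expr0n /= addr0 sqrtr_sqr ger0_norm. Qed.

Lemma normc_ge0 (z : R[i]) : 0 <= normc z.
Proof. by case: z => x y; rewrite /normc /= sqrtr_ge0. Qed.

Lemma normc_eq0 (z : R[i]) : (normc z == 0) = (z == 0).
Proof. by apply/eqP/eqP => [/eq0_normc|->] //; rewrite normc0. Qed.

Lemma ler_normc_sum (I : Type) (s : seq I) (P : pred I) (F : I -> R[i]) :
  normc (\sum_(i <- s | P i) F i) <= \sum_(i <- s | P i) normc (F i).
Proof.
elim/big_ind2: _ => [|x a y b hx hy|//]; first by rewrite normc0.
by apply: le_trans (le_normcD _ _) _; apply: lerD.
Qed.

Lemma triangle_phases (a d r : R) : 0 <= a -> 0 <= d -> 0 <= r ->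
    a <= d + r -> d <= a + r -> r <= a + d ->
  exists u v : R[i], [/\ normc u = 1, normc v = 1 & a%:C * u + d%:C * v = r%:C].
Proof.
move=> a0 d0 r0 ha hd hr.
have [ra0|ra_neq0] := eqVneq (r * a) 0.
  have [r_0|a_0] : r = 0 \/ a = 0.
    by move/eqP: ra0; rewrite mulf_eq0 => /orP[] /eqP; [left|right].
  - exists 1, (-1); rewrite normcN normc1; split=> //.
    have -> : a = d by lra.
    by rewrite r_0 mulr1 mulrN1 subrr.
  exists 1, 1; rewrite normc1; split=> //.
  have -> : d = r by lra.
  by rewrite a_0 mul0r add0r mulr1.
have [r_neq0 a_neq0] : r != 0 /\ a != 0.
  by move: ra_neq0; rewrite mulf_eq0 negb_or => /andP[].
(* the law of cosines: x is the cosine of the angle between the sides a and r *)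
pose x := (r ^+ 2 + a ^+ 2 - d ^+ 2) / (2 * r * a).
have x2_le1 : 0 <= 1 - x ^+ 2.
  have -> : 1 - x ^+ 2 =
      ((a + r - d) * (a + r + d)) * ((d - a + r) * (d + a - r))
        / (2 * r * a) ^+ 2.
    by rewrite /x; field; rewrite r_neq0 a_neq0.
  by rewrite !mulr_ge0 ?invr_ge0 ?sqr_ge0 //; lra.
pose y := Num.sqrt (1 - x ^+ 2).
have y2 : y ^+ 2 = 1 - x ^+ 2 by rewrite sqr_sqrtr.
pose w : R[i] := (r - a * x) +i* (- (a * y)).
have w_norm : normc w = d.
  rewrite /normc /w /=; have -> : (r - a * x) ^+ 2 + (- (a * y)) ^+ 2 = d ^+ 2.
    have -> : (r - a * x) ^+ 2 + (- (a * y)) ^+ 2 =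
      r ^+ 2 - 2 * r * a * x + a ^+ 2 * (x ^+ 2 + y ^+ 2) by ring.
    by rewrite y2 /x; field; rewrite r_neq0 a_neq0.
  by rewrite sqrtr_sqr ger0_norm.
have w_split : a%:C * (x +i* y) + w = r%:C.
  by rewrite /w; simpc; congr (_ +i* _); ring.
have u1 : normc (x +i* y) = 1.
  by rewrite /normc /= y2 addrCA subrr addr0 sqrtr1.
have [d_0|d_neq0] := eqVneq d 0.
  exists (x +i* y), 1; rewrite normc1 u1; split=> //.
  by rewrite -w_split d_0 mul0r (eq0_normc (etrans w_norm d_0)).
exists (x +i* y), (w / d%:C); split=> //.
  by rewrite normcM normcV w_norm normc_nneg // divff.
rewrite mulrCA divff ?mulr1 // -normc_eq0 normc_nneg //.
Qed.

(** Sides [a i], [i] in [s], together with a side [r] that has phase -1.  The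
    extra real side lets the induction cut a triangle off the polygon along a
    diagonal and close the rest with that diagonal as its distinguished
    side. *)
Lemma polygon_phases (I : eqType) (s : seq I) (a : I -> R) (r : R) :
    uniq s -> (forall i, 0 <= a i) -> 0 <= r ->
    r <= \sum_(i <- s) a i ->
    (forall i, i \in s -> 2 * a i <= r + \sum_(i <- s) a i) ->
  exists2 u : I -> R[i], forall i, normc (u i) = 1
    & \sum_(i <- s) (a i)%:C * u i = r%:C.
Proof.
move=> + a0; elim: s r => [|k s IHs] r.
  move=> _ r0; rewrite big_nil => r_le0 _; exists (fun=> 1).
    by move=> i; rewrite normc1.
  by rewrite big_nil; have -> : r = 0 by lra.
move=> /= /andP[kNs s_uniq] r0; rewrite big_cons.
set S := \sum_(i <- s) a i => hr ha.
have S0 : 0 <= S by apply: sumr_ge0.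
have aS i : i \in s -> a i <= S.
  move=> i_s; rewrite /S (big_rem i) //= lerDl; exact: sumr_ge0.
have hk := ha k (mem_head _ _).
(* d is the length of the diagonal that cuts off the triangle with sides a k
   and r; the longest diagonal that both the triangle and the remaining sides
   can span satisfies all the inequalities on both parts *)
pose d := Num.min (a k + r) S.
have dle1 : d <= a k + r by rewrite /d ge_min lexx.
have dle2 : d <= S by rewrite /d ge_min lexx orbT.
have := a0 k => ak0.
have d_cases : d = a k + r \/ d = S.
  by rewrite /d; case: (leP (a k + r) S); [left|right].
have d0 : 0 <= d by case: d_cases => ->; lra.
have [] := IHs d s_uniq d0 dle2.
  move=> i i_s; have hi := ha i (mem_behead (s := k :: s) i_s).
  by have ai := aS i i_s; case: d_cases => ->; rewrite -/S; lra.
move=> u u1 hu.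
have [||||||v [w [v1 w1 vw]]] := @triangle_phases (a k) d r => //;
  try by case: d_cases => ->; lra.
exists (fun i => if i == k then v else w * u i).
  by move=> i; case: eqP => // _; rewrite normcM w1 u1 mulr1.
rewrite big_cons eqxx -vw -hu mulrC mulr_suml [v * _]mulrC; congr (_ + _).
rewrite [LHS]big_seq [RHS]big_seq; apply: eq_bigr => i i_s.
case: eqP => [ik|_]; first by rewrite -ik i_s in kNs.
by rewrite mulrCA mulrC.
Qed.

End Polygons.

(** * Helly's theorem for convex cones in an orthant *)

Section Helly.
Context {F : realFieldType} {n : nat} {T : finType}.

Lemma exists_linear_dependence (S : {set T}) (p : T -> 'rV[F]_n) :
    (n < #|S|)%N ->
  exists c : T -> F,
    (exists2 j, j \in S & c j != 0) /\ \sum_(j in S) c j *: p j = 0.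
Proof.
move=> S_big.
pose A : 'M[F]_(#|S|, n) := \matrix_i p (enum_val i).
have : kermx A != 0.
  rewrite kermx_eq0 /row_free; apply/eqP => rA.
  by have := rank_leq_col A; rewrite rA leqNgt S_big.
case/rowV0Pn => v /sub_kermxP vA v_neq0.
have [i vi] : exists i, v 0 i != 0.
  apply/existsP; apply: contraR v_neq0 => /existsPn v0; apply/eqP/rowP => i.
  by rewrite mxE; apply/eqP; rewrite -[_ == _]negbK v0.
have S0 : enum_val i \in S := enum_valP i.
exists (fun j => v 0 (enum_rank_in S0 j)); split.
  by exists (enum_val i) => //; rewrite enum_valK_in.
rewrite big_enum_val /= -[RHS]vA mulmx_sum_row; apply: eq_bigr => k _.
by rewrite enum_valK_in rowK.
Qed.

(** Helly's theorem for sets in a simplex, with the cones over them in place of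
    the sets: the bound is [n] rather than [n + 1] because the simplex of the
    orthant of [F^n] has dimension [n - 1].  Working with cones, a linear
    dependence replaces the affine dependence of Radon's theorem, and no
    normalisation is needed; since points of the orthant cannot cancel, a
    nonnegative combination of nonzero points vanishes only trivially. *)
Theorem helly_cones (K : T -> set 'rV[F]_n) :
    (forall j, K j 0) ->
    (forall j x y, K j x -> K j y -> K j (x + y)) ->
    (forall j c x, 0 <= c -> K j x -> K j (c *: x)) ->
    (forall j x i, K j x -> 0 <= x 0 i) ->
    (n <= #|T|)%N ->
    (forall S : {set T}, #|S| = n ->
       exists2 x, x != 0 & forall j, j \in S -> K j x) ->
  exists2 x, x != 0 & forall j, K j x.
Proof.
move=> K0 KD KZ K_ge0 nT base.
suff all_sizes k (S : {set T}) : #|S| = (n + k)%N ->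
    exists2 x, x != 0 & forall j, j \in S -> K j x.
  have [|x x0 Kx] := all_sizes (#|T| - n)%N [set: T]; last first.
    by exists x => // j; apply: Kx; rewrite finset.in_setT.
  by rewrite cardsT subnKC.
elim: k S => [|k IHk] S cardS; first by apply: base; rewrite cardS addn0.
(* for j in S, p j lies in all the cones indexed by S except perhaps the j-th *)
have [j|p hp] := @fin_all_exists T (fun=> 'rV[F]_n)
    (fun j x => j \in S -> x != 0 /\ forall l, l \in S :\ j -> K l x).
  have [jS|] := boolP (j \in S); last by exists 0.
  have [|x x0 Kx] := IHk (S :\ j); last by exists x.
  by move: cardS; rewrite (cardsD1 j) jS addnS => -[].
have [|c [[j jS cj] dep]] := @exists_linear_dependence S p.
  by rewrite cardS addnS ltnS leq_addr.
have Ksum (P : pred T) (b : T -> F) l : (forall j, P j -> 0 <= b j) ->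
    l \in S -> ~~ P l -> K l (\sum_(j in S | P j) b j *: p j).
  move=> b0 lS Pl; elim/big_ind: _ => [||i /andP[iS Pi]] //; first exact: KD.
  apply: KZ; first exact: b0.
  apply: (hp i iS).2; rewrite !inE lS andbT.
  by apply: contra Pl => /eqP ->.
have p_ge0 l i : l \in S -> 0 <= p l 0 i.
  (* p l lies in the cone of any other index of S, and there is one since
     S has more than n > 0 elements *)
  move=> lS; case: (set_0Vmem (S :\ l)) => [Sl0|].
    have n_gt0 := leq_ltn_trans (leq0n i) (ltn_ord i).
    by move: (cardsD1 l S); rewrite lS Sl0 cards0 cardS; lia.
  by case=> l' l'S; apply: (K_ge0 l'); apply: (hp l lS).2.
have sum_eq0 (P : pred T) (b : T -> F) l : (forall j, P j -> 0 <= b j) ->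
    l \in S -> P l -> \sum_(j in S | P j) b j *: p j = 0 -> b l = 0.
  move=> b0 lS Pl /rowP q0.
  have /rV0Pn[i pli] := (hp l lS).1.
  have := q0 i; rewrite summxE mxE => /psumr_eq0P qi.
  have : (b l *: p l) 0 i = 0.
    apply: qi => [j' /andP[jS' Pj']|]; last by rewrite lS.
    by rewrite mxE mulr_ge0 ?b0 ?p_ge0.
  by move/eqP; rewrite mxE mulf_eq0 (negPf pli) orbF => /eqP.
(* Radon's argument: the two halves of the dependence, by the sign of c, are
   the same point, and the l-th cone contains the half in which p l is absent *)
pose q1 := \sum_(j in S | 0 < c j) c j *: p j.
pose q2 := \sum_(j in S | ~~ (0 < c j)) (- c j) *: p j.
have q12 : q1 = q2.
  apply/eqP; rewrite -subr_eq0 -dep (bigID (fun j => 0 < c j)) /= /q2 -sumrN.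
  by under [X in _ + X == _]eq_bigr do rewrite scaleNr opprK.
have c_ge0 l : 0 < c l -> 0 <= c l by exact: ltW.
have Nc_ge0 l : ~~ (0 < c l) -> 0 <= - c l by rewrite -leNgt oppr_ge0.
exists q1.
  apply: contra cj => /eqP q0; have [cj|cj] := boolP (0 < c j).
    by rewrite (sum_eq0 _ _ _ c_ge0 jS cj q0).
  by rewrite -oppr_eq0 (sum_eq0 _ _ _ Nc_ge0 jS cj (etrans (esym q12) q0)).
move=> l lS; have [cl|cl] := boolP (0 < c l); last exact: Ksum.
by rewrite q12; apply: Ksum => //; rewrite negbK.
Qed.

End Helly.

(** * Moduli of rank-deficient matrices *)

Section Moduli.
Context {R : rcfType}.

(** Writing [t] for the moduli of the coefficients of a row relation, the
    [j]-th column of the relation is a closed polygon with sides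
    [t 0 i * rho i j]: no side exceeds the sum of the others. *)
Definition balanced n m (rho : 'M[R]_(n, m)) (j : 'I_m) : set 'rV[R]_n :=
  [set t | forall i, 0 <= t 0 i /\
     2 * (t 0 i * rho i j) <= \sum_k t 0 k * rho k j]%classic.

(** One term of a vanishing sum is minus the sum of the others, so the triangle
    inequality bounds its modulus. *)
Lemma balanced_of_kernel n m (z : 'M[R[i]]_(n, m)) (v : 'rV_n) j :
  v *m z = 0 -> balanced (map_mx (@normc R) z) j (map_mx (@normc R) v).
Proof.
move=> vz i; rewrite mxE; split; first exact: normc_ge0.
have := congr1 (fun w : 'rV_m => w 0 j) vz; rewrite mxE [RHS]mxE (bigD1 i) //=.
move/eqP; rewrite addr_eq0 => /eqP vz_i.
rewrite mulr2n mulrDl mul1r [leRHS](bigD1 i) //= !mxE -normcM lerD2l vz_i normcN.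
apply: le_trans (ler_normc_sum _ _ _) _.
by apply: ler_sum => k _; rewrite !mxE normcM.
Qed.

(** The columns are independent of each other: each closes its own polygon, and
    the row relation can be taken to be [t] itself, without phases. *)
Lemma kernel_of_balanced n m (rho : 'M[R]_(n, m)) (t : 'rV_n) :
    (forall i j, 0 <= rho i j) -> (forall j, balanced rho j t) ->
  exists2 z : 'M[R[i]]_(n, m), map_mx (@normc R) z = rho
    & map_mx (real_complex R) t *m z = 0.
Proof.
move=> rho0 bal.
have t0 (j : 'I_m) i : 0 <= t 0 i := (bal j i).1.
have [j|u hu] := @fin_all_exists 'I_m (fun=> 'I_n -> R[i]) (fun j u =>
    (forall i, normc (u i) = 1) /\ \sum_i (t 0 i * rho i j)%:C * u i = 0).
  have S0 : 0 <= \sum_i t 0 i * rho i j.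
    by apply: sumr_ge0 => i _; rewrite mulr_ge0 ?(t0 j).
  have [|i _|u u1 hu] := @polygon_phases R _ (index_enum 'I_n)
      (fun i => t 0 i * rho i j) 0 (index_enum_uniq _) _ (lexx 0) S0.
  - by move=> i; rewrite mulr_ge0 ?(t0 j).
  - by rewrite add0r; exact: (bal j i).2.
  by exists u.
exists (\matrix_(i, j) ((rho i j)%:C * u j i)).
  by apply/matrixP => i j; rewrite !mxE normcM (hu j).1 mulr1 normc_nneg.
apply/rowP => j; rewrite !mxE -[RHS](hu j).2; apply: eq_bigr => i _.
by rewrite !mxE mulrA rmorphM.
Qed.

Lemma balanced_colsub n m k (f : 'I_k -> 'I_m) (rho : 'M[R]_(n, m)) j :
  balanced (colsub f rho) j = balanced rho (f j).
Proof.
apply: eq_set => t; apply: eq_forall => i; rewrite mxE.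
by under eq_bigr do rewrite mxE.
Qed.

Lemma balanced0 n m (rho : 'M[R]_(n, m)) j : balanced rho j 0.
Proof.
move=> i; rewrite mxE mul0r mulr0; split=> //.
by rewrite big1 // => k _; rewrite mxE mul0r.
Qed.

Lemma balanced_scale_add n m (rho : 'M[R]_(n, m)) j c x y : 0 <= c ->
  balanced rho j x -> balanced rho j y -> balanced rho j (c *: x + y).
Proof.
move=> c0 x_bal y_bal i; have [x0 hx] := x_bal i; have [y0 hy] := y_bal i.
rewrite !mxE; split; first by rewrite addr_ge0 ?mulr_ge0.
have -> : \sum_k (c *: x + y) 0 k * rho k j =
    c * (\sum_k x 0 k * rho k j) + \sum_k y 0 k * rho k j.
  by rewrite mulr_sumr -big_split; apply: eq_bigr => k _; rewrite !mxE /=; ring.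
by have := ler_wpM2l c0 hx; lra.
Qed.

Lemma increasing_enumeration n m (S : {set 'I_m}) : #|S| = n ->
  exists2 f : 'I_n -> 'I_m, {homo f : i j / (i < j)%N}
    & forall j, j \in S -> exists i, f i = j.
Proof.
move=> cardS; case: n cardS => [/eqP|n] cardS.
  have f (i : 'I_0) : 'I_m by case: i.
  exists f => [[]//|j].
  by move: cardS; rewrite cards_eq0 => /eqP ->; rewrite inE.
have [x0 _] : exists x0, x0 \in S by apply/set0Pn; rewrite -card_gt0 cardS.
have size_S : size (enum S) = n.+1 by rewrite -cardE.
exists (fun i => nth x0 (enum S) i).
  move=> i j ij.
  have srt : sorted (relpre (@nat_of_ord m) ltn) (enum S).
    rewrite /enum_mem; apply: sorted_filter.
      by move=> ? ? ?; apply: ltn_trans.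
    by rewrite -sorted_map -enumT val_enum_ord iota_ltn_sorted.
  have tr : transitive (relpre (@nat_of_ord m) ltn).
    by move=> ? ? ?; apply: ltn_trans.
  by apply: (sorted_ltn_nth tr x0 srt); rewrite ?inE ?size_S.
move=> j jS.
have hj : (index j (enum S) < n.+1)%N by rewrite -size_S index_mem mem_enum.
by exists (Ordinal hj); rewrite /= nth_index // mem_enum.
Qed.

(** If the moduli [rho] allow each maximal minor separately to vanish, with phases
    depending on the minor, then one choice of phases makes all of them
    vanish. *)
Theorem singular_minors_moduli n m (rho : 'M[R]_(n, m)) : (n <= m)%N ->
    (forall i j, 0 <= rho i j) ->
    (forall f : 'I_n -> 'I_m, {homo f : i j / (i < j)%N} ->
       exists2 z : 'M[R[i]]_n, map_mx (@normc R) z = colsub f rho & \det z = 0) ->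
  exists2 z : 'M[R[i]]_(n, m), map_mx (@normc R) z = rho
    & forall f : 'I_n -> 'I_m, \det (colsub f z) = 0.
Proof.
move=> nm rho0 minors.
have [|||||S cardS|t t_neq0 bal] := @helly_cones R n 'I_m (balanced rho).
- by move=> j; apply: balanced0.
- by move=> j x y x_bal y_bal; rewrite -[x]scale1r; apply: balanced_scale_add.
- move=> j c x c0 x_bal; rewrite -[_ *: _]addr0; apply: balanced_scale_add => //.
  exact: balanced0.
- by move=> j x i x_bal; have [] := x_bal i.
- by rewrite card_ord.
- have [f f_incr f_onto] := increasing_enumeration cardS.
  have [z z_rho /eqP/det0P[v v_neq0 vz]] := minors f f_incr.
  exists (map_mx (@normc R) v).
    have /rV0Pn[i vi] := v_neq0; apply/rV0Pn; exists i.
    by rewrite mxE normc_eq0.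
  move=> j /f_onto[i <-]; rewrite -balanced_colsub -z_rho.
  exact: balanced_of_kernel.
have [z z_rho tz] := kernel_of_balanced rho0 bal.
exists z => // f; apply/eqP/det0P; exists (map_mx (real_complex R) t).
  by rewrite map_mx_eq0.
by rewrite mulmx_colsub tz; apply/matrixP => i j; rewrite !mxE.
Qed.

End Moduli.

(** * The amoeba basis property *)

Section MaximalMinors.
Context {R : realType}.
Local Open Scope classical_set_scope.

Lemma zero_locus_ideal_gen N (B : set (mpoly N R[i])) :
  zero_locus (ideal_gen B) = zero_locus B.
Proof.
apply/seteqP; split=> z zB p Bp; first by apply: zB; exact: sub_gen_smallest.
apply: (smallest_sub (X := [set p | meval (z 0) p = 0]) _ _ Bp) => //.
split=> [|q r /= q0 r0|a q /= q0]; first exact: meval0.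
  by rewrite mevalD q0 r0 addr0.
by rewrite mevalM q0 mulr0.
Qed.

(** The logarithm takes the junk value 0 at 0, whereas [expR] is never 0: stated
    with exponentials, membership in an amoeba no longer mentions the torus. *)
Lemma amoebaP N (V : set 'rV[R[i]]_N) (a : 'rV[R]_N) :
  amoeba V a <-> exists2 z, V z & map_mx (@normc R) z = map_mx expR a.
Proof.
split=> [[z [Vz z_torus] <-]|[z Vz z_a]].
  exists z => //; apply/rowP => k; rewrite !mxE lnK // posrE.
  by rewrite lt0r normc_eq0 z_torus normc_ge0.
have z_exp k : normc (z 0 k) = expR (a 0 k).
  by have := congr1 (fun w : 'rV_N => w 0 k) z_a; rewrite !mxE.
exists z; last by apply/rowP => k; rewrite mxE z_exp expRK.
by split=> // k; rewrite -normc_eq0 z_exp gt_eqF // expR_gt0.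
Qed.

Lemma meval_minor n m (f : 'I_n -> 'I_m) (z : 'rV[R[i]]_(n * m)) :
  meval (z 0) (\det (colsub f (generic_matrix R n m))) =
  \det (colsub f (vec_mx z)).
Proof.
rewrite -det_map_mx; congr (\det _); apply/matrixP => i j.
by rewrite !mxE; exact: mevalXU.
Qed.

(** An increasing map is determined by its image: [f = g \o h] with [h] an
    increasing self-map of ['I_n], and such an [h] satisfies [i <= h i] by
    induction from below and [h i <= i] by induction from above. *)
Lemma increasing_image_eq n m (f g : 'I_n -> 'I_m) :
    {homo f : i j / (i < j)%N} -> {homo g : i j / (i < j)%N} ->
    (forall i, exists k, f i = g k) -> f =1 g.
Proof.
move=> f_incr g_incr /fin_all_exists[h fgh].
have g_inj : {mono g : i j / (i < j)%N}.
  move=> i j; case: (ltngtP i j) => [/g_incr//|/g_incr gji|/val_inj->].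
    by apply/negbTE; rewrite -leqNgt ltnW.
  by rewrite ltnn.
have h_incr (i j : 'I_n) : (i < j)%N -> (h i < h j)%N.
  by move=> /f_incr; rewrite !fgh g_inj.
have h_ge k (i : 'I_n) : val i = k -> (k <= h i)%N.
  elim: k i => // k IHk i ik.
  have lt_kn : (k < n)%N by apply: ltnW; rewrite -ik; exact: ltn_ord.
  apply: leq_ltn_trans (IHk (Ordinal lt_kn) erefl) (h_incr _ _ _).
  by move: ik => /= ->.
have h_le k (i : 'I_n) : (i + k).+1 = n -> (h i + k < n)%N.
  elim: k i => [|k IHk] i ik; first by rewrite addn0.
  have lt_in : (i.+1 < n)%N by lia.
  have := h_incr i (Ordinal lt_in) (ltnSn _).
  by have := IHk (Ordinal lt_in) _; rewrite /=; lia.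
move=> i; rewrite fgh; congr (g _); apply: val_inj => /=.
have := h_ge _ i erefl; have := h_le _ i (subnKC (ltn_ord i)).
have := ltn_ord i; rewrite /=; lia.
Qed.

Definition unit_columns n m (f : 'I_n -> 'I_m) : 'M[R[i]]_(n, m) :=
  \matrix_(i, j) (j == f i)%:R.

Lemma det_own_unit_columns n m (f : 'I_n -> 'I_m) :
  {homo f : i j / (i < j)%N} -> \det (colsub f (unit_columns f)) = 1.
Proof.
move=> f_incr; rewrite -(det1 _ n); congr (\det _); apply/matrixP => i j.
rewrite !mxE; congr (_%:R); congr nat_of_bool.
case: (ltngtP i j) => [ij|ij|/val_inj->]; last by rewrite !eqxx.
  by rewrite -!val_eqE /= gtn_eqF ?ltn_eqF ?f_incr.
by rewrite -!val_eqE /= ltn_eqF ?gtn_eqF ?f_incr.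
Qed.

Lemma columns_of_nonzero_minor n m (f g : 'I_n -> 'I_m) :
  \det (colsub g (unit_columns f)) != 0 -> forall j, exists k, g j = f k.
Proof.
move=> det_neq0 j; have [/existsP[k /eqP]|/existsPn gj] :=
  boolP [exists k, g j == f k]; first by exists k.
case/eqP: det_neq0.
rewrite (expand_det_col _ j) big1 // => i _.
by rewrite !mxE (negPf (gj i)) mul0r.
Qed.

(** A point common to the amoebas of the minors prescribes the moduli of all the
    entries and, for each minor, a zero with these moduli; only the entries in
    the columns of the minor matter there. *)
Lemma amoeba_maximal_minors n m : (n <= m)%N ->
  amoeba (zero_locus (maximal_minors (generic_matrix R n m))) =
  \bigcap_(f in maximal_minors (generic_matrix R n m)) amoeba_poly f.
Proof.
move=> nm; apply/seteqP; split=> [a /amoebaP[z zV z_a] p Bp|a a_minors].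
  by apply/amoebaP; exists z => // q ->; exact: zV.
have [i j|f f_incr|z z_a z_minors] :=
  @singular_minors_moduli R n m (vec_mx (map_mx expR a)) nm.
- by rewrite !mxE expR_ge0.
- have /amoebaP[z zf z_a] :
      amoeba_poly (\det (colsub f (generic_matrix R n m))) a.
    by apply: a_minors; exists f.
  exists (colsub f (vec_mx z)); first by rewrite map_mxsub map_vec_mx z_a.
  by rewrite -meval_minor; apply: zf.
apply/amoebaP; exists (mxvec z); last by rewrite map_mxvec z_a vec_mxK.
by move=> p [f f_incr ->]; rewrite meval_minor mxvecK.
Qed.

(** Membership in the ideal would force the minor to vanish at
    [unit_columns f], where all the other minors do. *)
Lemma minor_notin_ideal n m (f : 'I_n -> 'I_m)
    (B : set (mpoly (n * m) R[i])) :
    {homo f : i j / (i < j)%N} ->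
    B `<=` maximal_minors (generic_matrix R n m) ->
    ~ B (\det (colsub f (generic_matrix R n m))) ->
  ~ ideal_gen B (\det (colsub f (generic_matrix R n m))).
Proof.
move=> f_incr BM NBf IBf.
have zB : zero_locus (ideal_gen B) (mxvec (unit_columns f)).
  rewrite zero_locus_ideal_gen => p Bp; have [g g_incr pE] := BM p Bp.
  rewrite pE meval_minor mxvecK; apply/eqP.
  apply/negPn/negP => /columns_of_nonzero_minor g_f; apply: NBf.
  have /funext <- : g =1 f by apply: increasing_image_eq.
  by rewrite -pE.
have := zB _ IBf; rewrite meval_minor mxvecK det_own_unit_columns //.
by move/eqP; rewrite oner_eq0.
Qed.

End MaximalMinors.

Theorem corollary6p3 (R : realType) (n m : nat) (n_gt0 : (0 < n)%N)
    (le_nm : (n <= m)%N) :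
  amoeba_basis (ideal_gen (maximal_minors (generic_matrix R n m)))
    (maximal_minors (generic_matrix R n m)).
Proof.
split.
- apply: (@sub_finite_set _ _ [set \det (colsub (f : {ffun 'I_n -> 'I_m})
      (generic_matrix R n m)) | f in setT]%classic).
    move=> p [f _ ->]; exists [ffun i => f i]; first exact: I.
    by rewrite (_ : fun_of_fin _ = f) //; apply/funext => i; rewrite ffunE.
  by apply: finite_image; exact: finite_finset.
- exact: sub_gen_smallest.
- by split=> //; rewrite zero_locus_ideal_gen amoeba_maximal_minors.
move=> B [BM /existsNP[p /not_implyP[[f f_incr ->] NBf]]] [genB _].
apply: (minor_notin_ideal f_incr BM NBf); rewrite genB.
by apply: sub_gen_smallest; exists f.
Qed.
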